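(* Let $\mathbb{F}$ be a finite field with $q$ elements, $r_1,\dots,r_s$ positive integers, and $n=r_1\cdots r_s$ with $\gcd(n,q)=1$. Let $\leq_T$ be a fixed monomial ordering and let $C$ be an abelian code in $\mathbb{F}(r_1,\dots,r_s)$ with footprint $\Delta(C)$. Then (the classes of) the monomials in $\{\boldsymbol{X}^m\mid m\in\Delta(C)\}$ form an $\mathbb{F}$-basis of $\mathbb{F}(r_1,\dots,r_s)/C$. Hence $\dim_{\mathbb{F}}(C)=n-|\Delta(C)|$.
   Context: $\mathbb{F}[\boldsymbol{X}]=\mathbb{F}[X_1,\dots,X_s]$, $\boldsymbol{X}^m=X_1^{m_1}\cdots X_s^{m_s}$ for $m\in\mathbb{Z}^s_{\geq 0}$, $K=\langle X_1^{r_1}-1,\dots,X_s^{r_s}-1\rangle$ and $\mathbb{F}(r_1,\dots,r_s)=\mathbb{F}[\boldsymbol{X}]/K$. An abelian code is an ideal of $\mathbb{F}(r_1,\dots,r_s)$. For a monomial ordering $\leq_T$ on $\mathbb{Z}^s_{\geq0}$ and a nonzero polynomial $f=\sum_m f_m\boldsymbol{X}^m$, $\mathrm{LP}(f)$ is the $\leq_T$-largest exponent $m$ with $f_m\neq0$, and $\mathrm{LT}(f)=f_{\mathrm{LP}(f)}\boldsymbol{X}^{\mathrm{LP}(f)}$. A Groebner basis of an ideal $J$ is a finite set $\{g_1,\dots,g_t\}\subseteq J$ with $\langle \mathrm{LT}(g_1),\dots,\mathrm{LT}(g_t)\rangle=\langle \mathrm{LT}(f)\mid 0\ne f\in J\rangle$;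 it is minimal if its elements are monic and no $\mathrm{LT}(g_i)$ lies in the ideal generated by the other leading terms $\mathrm{LT}(g_j)$, $j\neq i$. For a code $C$, let $J$ be the unique ideal of $\mathbb{F}[\boldsymbol{X}]$ with $K\subseteq J$ and $J/K=C$, let $\mathcal{G}=\{g_1,\dots,g_t\}$ be a minimal Groebner basis of $J$ with respect to $\leq_T$, and put $A(\mathcal{G})=\bigcup_{i=1}^t\left(\mathrm{LP}(g_i)+\mathbb{Z}^s_{\geq0}\right)$, which does not depend on the choice of $\mathcal{G}$. The footprint of $C$ is $\Delta(C)=\mathbb{Z}^s_{\geq0}\setminus A(\mathcal{G})$. *)

(* Defs.v *)
From HB Require Import structures.
From mathcomp Require Import all_boot all_order all_algebra.
From mathcomp Require Import generic_quotient ring_quotient.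
From mathcomp Require Import finmap boolp classical_sets cardinality.
From mathcomp Require Import mpoly.

Set Implicit Arguments.
Unset Strict Implicit.
Unset Printing Implicit Defensive.

Import GRing.Theory.

Local Open Scope classical_set_scope.
Local Open Scope ring_scope.
Local Open Scope quotient_scope.

Section FiniteDimension.
Variables (F : fieldType) (V : lmodType F) (n : nat).
Variable g : {linear 'rV[F]_n -> V}.
Hypothesis g_surj : forall v, exists u, g u = v.

Lemma linear_kernel_mx : exists A : 'M[F]_n, forall u, (u <= A)%MS <-> g u = 0.
Proof.
pose P d := `[< exists2 A : 'M[F]_n,
  (forall u : 'rV_n, (u <= A)%MS -> g u = 0) & \rank A = d >].
have P0 : exists d, P d.
  exists 0; apply/asboolP; exists 0; last by rewrite mxrank0.
  by move=> u; rewrite submx0 => /eqP ->; rewrite linear0.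
have Pn d : P d -> (d <= n)%N by move=> /asboolP[A _ <-]; exact: rank_leq_row.
case: (ex_maxnP P0 Pn) => d /asboolP[A Ag Ad] dmax.
exists A => u; split=> [/Ag//|gu0]; apply: contrapT => /negP uA.
suff /dmax : P (\rank (A + u)%MS).
  by rewrite leqNgt -Ad rank_ltmx// /ltmx addsmxSl/= addsmx_sub submx_refl.
apply/asboolP; exists (A + u)%MS => // w /sub_addsmxP[[a b] /= ->].
rewrite linearD Ag ?submxMl// add0r.
by rewrite [b]mx11_scalar mul_scalar_mx linearZ/= gu0 scaler0.
Qed.

Lemma surj_vect_iso : exists d, exists2 f : V -> 'rV[F]_d, linear f & bijective f.
Proof.
have [A Ag] := linear_kernel_mx.
pose B := row_base A^C%MS.
pose h w := g (w *m B).
have hlin : linear h by move=> a x y; rewrite /h mulmxDl -scalemxAl linearP.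
have h_inj x y : h x = h y -> x = y.
  move=> /eqP; rewrite -subr_eq0 /h -linearB -mulmxBl => /eqP /Ag xyA.
  apply/eqP; rewrite -subr_eq0 -(mulmx_free_eq0 _ (row_base_free _)) -submx0.
  rewrite -(capmx_compl A) sub_capmx xyA /=.
  by rewrite (submx_trans (submxMl _ _)) ?eq_row_base.
have h_surj v : exists w, h w = v.
  have [u <-] := g_surj v.
  have : (u <= A + A^C)%MS by rewrite submx_full ?addsmx_compl_full.
  move=> /sub_addsmxP[[a b] /= ->].
  have /submxP[w bw] : (b *m A^C <= B)%MS by rewrite eq_row_base submxMl.
  exists w; rewrite linearD (Ag _).1 ?submxMl// add0r.
  by rewrite /h -bw.
have /choice[f hK] := h_surj.
exists (\rank A^C); exists f.
  by move=> a x y; apply: h_inj; rewrite hlin !hK.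
by exists h => // x; apply: h_inj; rewrite hK.
Qed.

Lemma surj_vect_axiom : {d & Vector.axiom d V}.
Proof.
have [d /cid2[f flin fbij]] := cid surj_vect_iso.
by exists d; exists f.
Qed.

End FiniteDimension.

Section GeneratedIdeal.
Variable R : comNzRingType.

Definition gen_ideal (S : set R) : set R :=
  [set x | exists2 c : seq (R * R), (forall p, p \in c -> S p.2) &
                                    x = \sum_(p <- c) p.1 * p.2].

Lemma gen_ideal0 S : gen_ideal S 0.
Proof. by exists [::]; rewrite ?big_nil. Qed.

Lemma gen_ideal_gen (S : set R) x : S x -> gen_ideal S x.
Proof.
move=> Sx; exists [:: (1, x)]; last by rewrite big_seq1 mul1r.
by move=> p; rewrite inE => /eqP ->.
Qed.

Lemma gen_ideal_lin S a x y :
  gen_ideal S x -> gen_ideal S y -> gen_ideal S (a * x + y).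
Proof.
move=> [c cS ->] [d dS ->]; exists ([seq (a * p.1, p.2) | p <- c] ++ d).
  by move=> p; rewrite mem_cat => /orP[/mapP[q /cS ? ->]//|/dS].
rewrite big_cat big_map mulr_sumr /=; congr (_ + _).
by apply: eq_bigr => p _; rewrite mulrA.
Qed.

End GeneratedIdeal.

(* Unlike idealr of ring_quotient, the structure ideal includes the whole ring. *)
HB.mixin Record isMulAbsorbing (R : comNzRingType) (S : R -> bool) := {
  ideal_absorb_subproof : forall a u, u \in (S : {pred R}) -> a * u \in (S : {pred R})
}.

#[short(type="ideal")]
HB.structure Definition Ideal (R : comNzRingType) :=
  {S of GRing.ZmodClosed R S & isMulAbsorbing R S}.

Lemma ideal_absorb (R : comNzRingType) (I : ideal R) (a u : R) :
  u \in I -> a * u \in I.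
Proof. exact: ideal_absorb_subproof. Qed.

Section MonomialOrder.
Variables (s : nat) (leT : rel 'X_{1..s}).

Definition monomial_order : Prop :=
  [/\ antisymmetric leT, transitive leT, total leT,
      forall m m1 m2, leT m1 m2 -> leT (m1 + m)%MM (m2 + m)%MM &
      forall P : set 'X_{1..s}, P !=set0 ->
        exists2 m, P m & forall m', P m' -> leT m m'].

Variable F : fieldType.
Implicit Types (f g : {mpoly F[s]}) (J : set {mpoly F[s]}).
Implicit Type G : {fset {mpoly F[s]}}.

(* Junk value 0%MM when f = 0. *)
Definition LP f : 'X_{1..s} := last 0%MM (sort leT (msupp f)).

Definition LC f : F := f@_(LP f).

Definition LT f : {mpoly F[s]} := LC f *: 'X_[LP f].

Definition groebner_basis J G : Prop :=
  [set` G] `<=` J /\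
  gen_ideal [set LT g | g in [set` G]] =
  gen_ideal [set LT f | f in [set f | J f /\ f != 0]].

Definition minimal_groebner_basis J G : Prop :=
  [/\ groebner_basis J G,
      forall g, g \in G -> LC g = 1 &
      forall g, g \in G ->
        ~ gen_ideal [set LT h | h in [set h | h \in G /\ h != g]] (LT g)].

Definition upset G : set 'X_{1..s} :=
  [set m | exists2 g, g \in G & exists k : 'X_{1..s}, m = (LP g + k)%MM].

End MonomialOrder.

Section CyclicIdeal.
Variables (F : fieldType) (s : nat) (r : 'I_s -> nat).

Definition cyclic_ideal : {pred {mpoly F[s]}} :=
  [pred f | `[< gen_ideal [set ('X_i ^+ r i - 1 : {mpoly F[s]}) | i in [set: 'I_s]] f >]].

Lemma cyclic_ideal_closed : idealr_closed cyclic_ideal.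
Proof.
split; first by apply/asboolP; exact: gen_ideal0.
  apply/negP => /asboolP[c cS /(congr1 (meval (fun=> 1)))/eqP].
  rewrite rmorph1 rmorph_sum/= big_seq big1 ?oner_eq0// => p /cS[i _ pE].
  by rewrite mevalM -pE mevalB rmorphXn /= mevalXU expr1n meval1 subrr mulr0.
move=> a x y /asboolP Kx /asboolP Ky.
by apply/asboolP; exact: gen_ideal_lin.
Qed.

HB.instance Definition _ := isIdealr.Build _ cyclic_ideal cyclic_ideal_closed.

(* F(r_1, ..., r_s) = F[X]/K. Positivity of the r_i only serves to make the
   canonical vectType structure (vect_abelian_alg) available. *)
Definition abelian_alg of (forall i, (0 < r i)%N) : Type :=
  {ideal_quot cyclic_ideal}.

Variable r_gt0 : forall i, (0 < r i)%N.
Local Notation R := (abelian_alg r_gt0).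

HB.instance Definition _ := GRing.ComNzRing.on R.

Definition cls (f : {mpoly F[s]}) : R := \pi_{ideal_quot cyclic_ideal} f.

Lemma cls_is_zmod_morphism : zmod_morphism cls.
Proof. exact: pi_is_zmod_morphism. Qed.
HB.instance Definition _ := GRing.isZmodMorphism.Build _ _ cls cls_is_zmod_morphism.

Lemma cls_is_monoid_morphism : monoid_morphism cls.
Proof. exact: pi_is_monoid_morphism. Qed.
HB.instance Definition _ := GRing.isMonoidMorphism.Build _ _ cls cls_is_monoid_morphism.

Lemma cls_surj (x : R) : exists f, cls f = x.
Proof. by exists (repr x); rewrite /cls reprK. Qed.

Definition alg_scale (a : F) (x : R) : R := cls a%:MP * x.

Fact alg_scaleA a b x : alg_scale a (alg_scale b x) = alg_scale (a * b) x.
Proof. by rewrite /alg_scale mulrA mpolyCM rmorphM. Qed.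
Fact alg_scale1 : left_id 1 alg_scale.
Proof. by move=> x; rewrite /alg_scale mpolyC1 rmorph1 mul1r. Qed.
Fact alg_scaleDr : right_distributive alg_scale +%R.
Proof. by move=> a x y; rewrite /alg_scale mulrDr. Qed.
Fact alg_scaleDl x : {morph alg_scale^~ x : a b / a + b}.
Proof. by move=> a b; rewrite /alg_scale mpolyCD rmorphD mulrDl. Qed.

HB.instance Definition _ := GRing.Zmodule_isLmodule.Build F R
  alg_scaleA alg_scale1 alg_scaleDr alg_scaleDl.

Fact alg_scaleAl (a : F) (x y : R) : a *: (x * y) = a *: x * y.
Proof. exact: mulrA. Qed.
HB.instance Definition _ := GRing.Lmodule_isLalgebra.Build F R alg_scaleAl.
HB.instance Definition _ := GRing.Lalgebra_isComAlgebra.Build F R.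

Fact cls_is_scalable : scalable cls.
Proof. by move=> a f; rewrite -mul_mpolyC rmorphM. Qed.
HB.instance Definition _ := GRing.isScalable.Build F _ _ _ cls cls_is_scalable.

Lemma cls_X_subU i (m : 'X_{1..s}) : (r i <= m i)%N ->
  cls 'X_[m] = cls 'X_[m - U_(i) *+ r i].
Proof.
move=> le_rm; apply/eqP; rewrite -subr_eq0 -raddfB /= /cls.
have /submK {1}<- : (U_(i) *+ r i <= m)%MM.
  apply/mnm_lepP => j; rewrite mulmnE mnm1E; case: eqP => [<-|_].
    by rewrite mul1n.
  by rewrite mul0n.
rewrite mpolyXD -{2}['X_[_ - _]]mulr1 -mulrBr.
rewrite -(raddf0 \pi_{ideal_quot cyclic_ideal}) -Quotient.idealrBE subr0.
apply: idealMr; apply/asboolP; apply: gen_ideal_gen; exists i => //.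
by rewrite mpolyXn.
Qed.

Definition mon_comb : 'rV[F]_#|{: 'X_{1..s < (\sum_i r i).+1}}| -> R :=
  fun u => \sum_j u 0 j *: cls 'X_[(enum_val j : 'X_{1..s < _})].

Fact mon_comb_is_linear : linear mon_comb.
Proof.
move=> a u v; rewrite /mon_comb scaler_sumr -big_split /=.
by apply: eq_bigr => j _; rewrite !mxE scalerDl scalerA.
Qed.
HB.instance Definition _ := GRing.isLinear.Build F _ R _ mon_comb mon_comb_is_linear.

Lemma mon_comb_surj (x : R) : exists u, mon_comb u = x.
Proof.
have monX (m : 'X_{1..s}) : exists u, mon_comb u = cls 'X_[m].
  have [k] := ubnP (mdeg m); elim: k m => // k IHk m.
  have [mlt _|mge] := ltnP (mdeg m) (\sum_i r i).+1.
    have := enum_rankK (BMultinom mlt).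
    move: (enum_rank _) => j0 j0E; exists (delta_mx 0 j0).
    rewrite /mon_comb (bigD1 j0)//= [X in _ + X]big1 => [|j jn].
      by rewrite mxE !eqxx scale1r j0E addr0.
    by rewrite mxE (negPf jn) andbF scale0r.
  have [i le_rm] : exists i, (r i <= m i)%N.
    apply: contrapT => /forallNP ltm; move: mge; rewrite ltnNge => /negP; apply.
    rewrite mdegE; apply: leq_sum => i _; apply: ltnW.
    by rewrite ltnNge; apply/negP/ltm.
  rewrite ltnS => mk; rewrite (cls_X_subU le_rm); apply: IHk.
  apply: leq_trans mk; rewrite !mdegE [X in (X < _)%N](bigD1 i)//=.
  rewrite [X in (_ < X)%N](bigD1 i)//= mnmBE mulmnE mnm1E eqxx mul1n.
  rewrite -addSn leq_add//; first by rewrite ltn_subrL r_gt0 (leq_trans _ le_rm)//.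
  by apply: leq_sum => j _; rewrite mnmBE leq_subr.
have /choice[u uE] := monX.
have [f <-] := cls_surj x; exists (\sum_(m <- msupp f) f@_m *: u m).
rewrite linear_sum [in RHS](mpolyE f) linear_sum; apply: eq_bigr => m _.
by rewrite !linearZ /= uE.
Qed.

Definition vect_abelian_alg := surj_vect_axiom mon_comb_surj.
HB.instance Definition _ :=
  Lmodule_hasFinDim.Build F R (projT2 vect_abelian_alg).

End CyclicIdeal.

Arguments abelian_alg F {s r} r_gt0.

Section Code.
Variables (F : fieldType) (s : nat) (r : 'I_s -> nat).
Variable r_gt0 : forall i, (0 < r i)%N.
Local Notation R := (abelian_alg F r_gt0).
Variable C : ideal R.

Definition code_quot : Type := {ideal_quot C}.

HB.instance Definition _ := GRing.Zmodule.on code_quot.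

Definition qcls (x : R) : code_quot := \pi_{ideal_quot C} x.

Fact qcls_is_zmod_morphism : zmod_morphism qcls.
Proof. exact: pi_is_zmod_morphism. Qed.
HB.instance Definition _ := GRing.isZmodMorphism.Build _ _ qcls qcls_is_zmod_morphism.

Lemma qcls_eq0 x : (qcls x == 0) = (x \in C).
Proof. by rewrite -(raddf0 qcls) /qcls -Quotient.idealrBE subr0. Qed.

Lemma qcls_repr (y : code_quot) : qcls (repr y) = y.
Proof. by rewrite /qcls reprK. Qed.

Lemma qcls_scale_repr (a : F) x : qcls (a *: repr (qcls x)) = qcls (a *: x).
Proof.
apply/eqP; rewrite -subr_eq0 -raddfB qcls_eq0 -scalerBr -mulr_algl.
by rewrite ideal_absorb// -qcls_eq0 raddfB /= qcls_repr subrr.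
Qed.

Definition quot_scale (a : F) (y : code_quot) : code_quot := qcls (a *: repr y).

Fact quot_scaleA a b y : quot_scale a (quot_scale b y) = quot_scale (a * b) y.
Proof. by rewrite /quot_scale qcls_scale_repr scalerA. Qed.
Fact quot_scale1 : left_id 1 quot_scale.
Proof. by move=> y; rewrite /quot_scale scale1r qcls_repr. Qed.
Fact quot_scaleDr : right_distributive quot_scale +%R.
Proof.
move=> a x y; rewrite /quot_scale -raddfD -scalerDr -[RHS]qcls_scale_repr.
by rewrite raddfD /= !qcls_repr.
Qed.
Fact quot_scaleDl y : {morph quot_scale^~ y : a b / a + b}.
Proof. by move=> a b; rewrite /quot_scale scalerDl raddfD. Qed.

HB.instance Definition _ := GRing.Zmodule_isLmodule.Build F code_quot
  quot_scaleA quot_scale1 quot_scaleDr quot_scaleDl.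

Fact qcls_is_scalable : scalable qcls.
Proof. by move=> a x; rewrite -qcls_scale_repr. Qed.
HB.instance Definition _ := GRing.isScalable.Build F _ _ _ qcls qcls_is_scalable.

Lemma qcls_mon_comb_surj (y : code_quot) :
  exists u, (qcls \o mon_comb r_gt0) u = y.
Proof.
have [u uE] := mon_comb_surj (repr y).
by exists u; rewrite /= uE qcls_repr.
Qed.

Definition vect_code_quot := surj_vect_axiom qcls_mon_comb_surj.
HB.instance Definition _ :=
  Lmodule_hasFinDim.Build F code_quot (projT2 vect_code_quot).

Definition code_space : {vspace R} := lker (linfun qcls).

Lemma mem_code_space x : (x \in code_space) = (x \in C).
Proof. by rewrite memv_ker lfunE /= qcls_eq0. Qed.

(* The ideal J of F[X] with K `<=` J and J/K = C. *)
Definition code_preim : set {mpoly F[s]} := [set f | cls r_gt0 f \in C].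

(* xget picks some minimal Groebner basis G of J. One exists because
   the set of leading exponents of the nonzero elements of J has finitely many
   minimal elements; upset leT G equals this set whatever the choice of G. *)
Definition footprint (leT : rel 'X_{1..s}) : set 'X_{1..s} :=
  ~` upset leT (xget fset0 (minimal_groebner_basis leT code_preim)).

End Code.

(* Main.v *)
(* The exponents outside the footprint are exactly the leading exponents of the
   nonzero elements of J. Hence a nonzero combination of footprint monomials is
   not in J, and a monomial outside the footprint is congruent modulo J to a
   combination of smaller ones, so that well-founded induction along <=_T
   shows that the footprint monomials span the quotient. The dimension formula
   follows by rank-nullity once F[X]/K is known to have dimension n, for which
   the monomials with all exponents m_i < r_i form a basis. *)
Require Import Defs.
From HB Require Import structures.
From mathcomp Require Import all_boot all_order all_algebra.
From mathcomp Require Import generic_quotient ring_quotient.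
From mathcomp Require Import finmap boolp classical_sets cardinality.
From mathcomp Require Import mpoly.

Set Implicit Arguments.
Unset Strict Implicit.
Unset Printing Implicit Defensive.

Import GRing.Theory.

Local Open Scope ring_scope.

(** * Independence and spanning for linear images of monomials *)

Lemma basis_of_dim (K : fieldType) (V : vectType K) (U : {vspace V})
  (X : seq V) : basis_of U X -> \dim U = size X.
Proof. by move=> UX; rewrite (vector.size_basis (X := in_tuple X) UX). Qed.

Section MonomialImages.
Variables (F : fieldType) (s : nat) (V : vectType F).
Variable h : {linear {mpoly F[s]} -> V}.

(** The coefficients of a vanishing combination assemble into a polynomial supported on [ms] and
    killed by [h]. *)
Lemma free_monomials (ms : seq 'X_{1..s}) : uniq ms ->
    (forall f, {subset msupp f <= ms} -> h f = 0 -> f = 0) ->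
  free [seq h 'X_[m] | m <- ms].
Proof.
move=> ms_uniq h_inj; apply/(@freeP _ _ _ (map_tuple _ (in_tuple ms))) => c hc0 i.
pose f : {mpoly F[s]} := \sum_(j < size ms) c j *: 'X_[tnth (in_tuple ms) j].
have /tuple_uniqP t_inj : uniq (in_tuple ms) := ms_uniq.
have fE j : f@_(tnth (in_tuple ms) j) = c j.
  rewrite raddf_sum /= (bigD1 j) //= big1 ?addr0 => [|k kj].
    by rewrite mcoeffZ mcoeffX eqxx mulr1.
  rewrite mcoeffZ mcoeffX (inj_eq t_inj).
  by rewrite (negPf kj) mulr0.
suff f0 : f = 0 by rewrite -fE f0 mcoeff0.
apply: h_inj => [m|].
  apply: contraLR => m_ms; rewrite mcoeff_msupp negbK raddf_sum /= big1 // => k _.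
  rewrite mcoeffZ mcoeffX; case: eqP => [mE|_]; last by rewrite mulr0.
  by case/negP: m_ms; rewrite -mE mem_tnth.
rewrite -hc0 linear_sum; apply: eq_bigr => j _.
by rewrite linearZ (nth_map 0%MM) // (tnth_nth 0%MM).
Qed.

Lemma span_monomials (X : seq V) : (forall v, exists f, h f = v) ->
  (forall m, h 'X_[m] \in <<X>>%VS) -> <<X>>%VS = fullv.
Proof.
move=> h_surj hX; apply/vspaceP => v; rewrite memvf; have [f <-] := h_surj v.
rewrite [f]mpolyE linear_sum; apply: rpred_sum => m _.
by rewrite linearZ rpredZ.
Qed.

End MonomialImages.

(** * Monomial orders and leading exponents *)

Section LeadingTerms.
Variables (s : nat) (leT : rel 'X_{1..s}).
Hypothesis leT_mon : monomial_order leT.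
Variable F : fieldType.
Implicit Types (f g : {mpoly F[s]}) (J : set {mpoly F[s]}) (m : 'X_{1..s}).
Implicit Type G : {fset {mpoly F[s]}}.

Lemma monomial_order_refl : reflexive leT.
Proof. by case: leT_mon => _ _ tot _ _ m; have := tot m m; rewrite orbb. Qed.

(* If m < 0 then the multiples of m form a set without a least element. *)
Lemma monomial_order0 m : leT 0%MM m.
Proof.
have [anti _ tot add wf] := leT_mon.
have /orP[//|m0] := tot 0%MM m.
have [|_ [k ->] kmin] := wf (fun m' => exists k, m' = (m *+ k)%MM).
  by exists m; exists 1%N; rewrite mulm1n.
have /anti : leT (m *+ k)%MM (m *+ k.+1)%MM && leT (m *+ k.+1)%MM (m *+ k)%MM.
  rewrite kmin; last by exists k.+1.
  by have := add (m *+ k)%MM _ _ m0; rewrite -mulmS add0m => ->.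
rewrite mulmS => /esym/eqP; rewrite -{2}[(m *+ k)%MM]add0m eqm_add2r => /eqP ->.
exact: monomial_order_refl.
Qed.

Lemma LP_supp f : f != 0 -> LP leT f \in msupp f.
Proof.
rewrite -msupp_eq0 /LP -(mem_sort leT).
have : size (sort leT (msupp f)) = size (msupp f) by rewrite size_sort.
case: (sort leT _) => [|x l]; last by rewrite /= mem_last.
by move/esym/size0nil => ->.
Qed.

Lemma LP_max f m : m \in msupp f -> leT m (LP leT f).
Proof.
have [_ tr tot _ _] := leT_mon.
rewrite -(mem_sort leT) /LP.
have := sort_sorted tot (msupp f).
elim/last_ind: (sort leT _) => // l x _; rewrite last_rcons mem_rcons inE.
move=> l_sorted /orP[/eqP ->|ml]; first exact: monomial_order_refl.
(* Reversal brings the last element of the sorted list to the head, where transitivity compares it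
   with all others. *)
move: l_sorted; rewrite -rev_sorted rev_rcons /= => /order_path_min/allP.
by apply; rewrite ?mem_rev // => y x' z /= h1 h2; apply: tr h2 h1.
Qed.

Lemma LP_eq f m : m \in msupp f -> {in msupp f, forall m', leT m' m} ->
  LP leT f = m.
Proof.
have [anti _ _ _ _] := leT_mon.
move=> mf mmax; apply: anti; rewrite LP_max // mmax // LP_supp //.
by rewrite -msupp_eq0; case: (msupp f) mf.
Qed.

Lemma LC_neq0 f : f != 0 -> LC leT f != 0.
Proof. by move/LP_supp; rewrite mcoeff_msupp. Qed.

Lemma LP_scale (a : F) f : a != 0 -> LP leT (a *: f) = LP leT f.
Proof.
move=> a0; have [->|f0] := eqVneq f 0; first by rewrite scaler0.
have suppE : msupp (a *: f) =i msupp f by apply/perm_mem/msuppZ.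
by apply: LP_eq => [|m]; rewrite suppE ?LP_supp //; apply: LP_max.
Qed.

Lemma mem_msupp_mulX f k m :
  (m \in msupp ('X_[k] * f)) = (k <= m)%MM && ((m - k)%MM \in msupp f).
Proof.
rewrite mulrC; apply/idP/andP.
  rewrite (perm_mem (msuppMX _ _)) => /mapP[m' m'f ->].
  by rewrite lem_addr addmC addmK.
move=> [km mf]; rewrite (perm_mem (msuppMX _ _)).
by apply/mapP; exists (m - k)%MM => //; rewrite addmC submK.
Qed.

Lemma LP_mulX f k : f != 0 -> LP leT ('X_[k] * f) = (LP leT f + k)%MM.
Proof.
have [_ _ _ add _] := leT_mon.
move=> f0; apply: LP_eq => [|m]; rewrite mem_msupp_mulX.
  by rewrite addmK lem_addl LP_supp.
by case/andP=> km mf; rewrite -[m](submK km); apply/add/LP_max.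
Qed.

Definition lead_exps J : set 'X_{1..s} :=
  [set LP leT f | f in [set f | J f /\ f != 0]].

Lemma gen_ideal_sub (R : comNzRingType) (S T : set R) :
  (S `<=` gen_ideal T -> gen_ideal S `<=` gen_ideal T)%classic.
Proof.
move=> ST x [c cS ->]; elim: c cS => [|p c IHc] cS.
  by rewrite big_nil; apply: gen_ideal0.
rewrite big_cons; apply: gen_ideal_lin.
  by apply/ST/cS; rewrite mem_head.
by apply: IHc => q qc; apply: cS; rewrite inE qc orbT.
Qed.

(** The support of a sum lies in the union of the supports, and every exponent in a multiple of
    [LT leT g] is divisible by [LP leT g]. *)
Lemma gen_ideal_LT_supp (S : set {mpoly F[s]}) f m :
    gen_ideal [set LT leT g | g in S]%classic f -> m \in msupp f ->
  exists2 g, S g & (LP leT g <= m)%MM.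
Proof.
move=> [c cS ->]; elim: c cS => [|p c IHc] cS.
  by rewrite big_nil msupp0.
rewrite big_cons => /msuppD_le; rewrite mem_cat => /orP[|mc]; last first.
  by apply: IHc => // q qc; apply: cS; rewrite inE qc orbT.
have [|g Sg <-] := cS p; first by rewrite mem_head.
rewrite /LT -scalerAr => /msuppZ_le; rewrite mulrC mem_msupp_mulX.
by case/andP=> gm _; exists g.
Qed.

Lemma msupp_LT f : f != 0 -> LP leT f \in msupp (LT leT f).
Proof.
by move=> f0; rewrite mcoeff_msupp mcoeffZ mcoeffX eqxx mulr1 LC_neq0.
Qed.

(** * Leading exponents of an ideal and minimal Groebner bases *)

Section Ideal.
Variable J : set {mpoly F[s]}.
Hypothesis J_lin : forall a f g, J f -> J g -> J (a * f + g).
Hypothesis J0 : J 0.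

Let J_mul a f : J f -> J (a * f).
Proof. by move=> Jf; rewrite -[a * f]addr0; apply: J_lin. Qed.

Lemma lead_exps_monic m : lead_exps J m ->
  exists f, [/\ J f, LP leT f = m & LC leT f = 1].
Proof.
move=> [f [Jf f0] <-]; exists ((LC leT f)^-1 *: f).
have a0 : (LC leT f)^-1 != 0 by rewrite invr_eq0 LC_neq0.
rewrite {3}/LC LP_scale // mcoeffZ mulVf ?LC_neq0 //; split=> //.
by rewrite -mul_mpolyC; apply: J_mul.
Qed.

Lemma lead_exps_up m k : lead_exps J m -> lead_exps J (m + k)%MM.
Proof.
move=> [f [Jf f0] <-]; exists ('X_[k] * f); last exact: LP_mulX.
split; first exact: J_mul.
by rewrite mulf_neq0 // -msupp_eq0 msuppX.
Qed.

(** Leading exponents are stable under addition of exponents; conversely, [LT leT f] lies in the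
    monomial ideal of the basis, so some basis leading exponent divides [LP leT f]. *)
Lemma upset_lead_exps G : minimal_groebner_basis leT J G ->
  upset leT G = lead_exps J.
Proof.
move=> [[GJ Ggen] Gmonic _]; apply/seteqP; split=> m /=.
  move=> [g gG [k ->]]; apply: lead_exps_up; exists g => //; split.
    exact: GJ.
  (* Being monic excludes the zero polynomial, whose [LP] is a junk value. *)
  apply: contra_eq_neq (Gmonic g gG) => ->.
  by rewrite /LC mcoeff0 eq_sym oner_neq0.
move=> [f [Jf f0] <-].
have : gen_ideal [set LT leT g | g in [set` G]]%classic (LT leT f).
  by rewrite Ggen; apply: gen_ideal_gen; exists f.
move=> /gen_ideal_LT_supp /(_ (msupp_LT f0)) [g gG gf].
by exists g => //; exists (LP leT f - LP leT g)%MM; rewrite addmC submK.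
Qed.

(** Minimality is meant for divisibility, not for [leT]. *)
Definition min_lead_exps : set 'X_{1..s} :=
  [set m | lead_exps J m /\ forall m', lead_exps J m' -> (m' <= m)%MM -> m' = m]%classic.

(** Induction on the total degree, which drops strictly at a proper divisor. *)
Lemma min_lead_exps_below m : lead_exps J m ->
  exists2 m', min_lead_exps m' & (m' <= m)%MM.
Proof.
have [k] := ubnP (mdeg m); elim: k m => // k IHk m mk Jm.
have [|] := pselect (min_lead_exps m); first by exists m => //; apply: lepm_refl.
move=> /not_andP[//|] /existsNP[m' /not_implyP[Jm' /not_implyP[m'm m'Nm]]].
have [|m1 m1_min m1m'] := IHk m' _ Jm'.
  rewrite -ltnS; apply: leq_trans mk; rewrite ltnS -(submK m'm) mdegD.
  rewrite -[X in (X < _)%N]add0n ltn_add2r lt0n mdeg_eq0.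
  by apply: contra_notN m'Nm => /eqP m0; rewrite -(submK m'm) m0 add0m.
by exists m1 => //; apply: lepm_trans m1m' m'm.
Qed.

(** One monic element of [J] is chosen over each minimal leading exponent [m], so that its leading
    term is ['X_[m]]. *)
Lemma minimal_groebner_basis_exists : finite_set min_lead_exps ->
  exists G, minimal_groebner_basis leT J G.
Proof.
move=> min_fin.
have /choice[g gP] : forall m, exists f, min_lead_exps m ->
    [/\ J f, LP leT f = m & LC leT f = 1].
  move=> m; have [[/lead_exps_monic[f fP] _]|] := pselect (min_lead_exps m).
    by exists f.
  by exists 0.
have mem_min m : m \in fset_set min_lead_exps -> min_lead_exps m.
  by rewrite in_fset_set // => /set_mem.
have LTg m : min_lead_exps m -> LT leT (g m) = 'X_[m].
  by move=> /gP[_ gm g1]; rewrite /LT g1 gm scale1r.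
exists [fset g m | m in fset_set min_lead_exps]%fset; split; first split.
- by move=> f /= /imfsetP[m /= /mem_min/gP[Jg _ _] ->].
- apply/seteqP; split; apply: gen_ideal_sub => x [f /=].
    move=> /imfsetP[m /= /mem_min/gP[Jg gm g1] ->] <-.
    apply: gen_ideal_gen; exists (g m) => //; split=> //.
    apply: contra_eq_neq g1 => ->.
    by rewrite /LC mcoeff0 eq_sym oner_neq0.
  move=> [Jf f0] <-.
  have [|m m_min mf] := @min_lead_exps_below (LP leT f); first by exists f.
  rewrite /LT -(submK mf) mpolyXD -(LTg m m_min) scalerAl -[X in gen_ideal _ X]addr0.
  apply: gen_ideal_lin; last exact: gen_ideal0.
  apply: gen_ideal_gen; exists (g m) => //=.
  by apply/imfsetP; exists m => //=; rewrite in_fset_set // mem_set.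
- by move=> f /imfsetP[m /= /mem_min/gP[_ _ g1] ->].
(* A leading term generated by the others would be divisible by another minimal exponent; minimality
   makes the two equal, hence also the two basis elements. *)
- move=> f /imfsetP[m /= /mem_min m_min ->]; rewrite LTg // => /gen_ideal_LT_supp.
  move=> /(_ m); rewrite msuppX mem_head => /(_ isT) [h /= [/imfsetP[m' /= m'_in ->]]].
  move/mem_min: m'_in => m'_min; have [_ -> _] := gP m' m'_min => gm' m'm.
  case: m_min => _ /(_ m' (proj1 m'_min) m'm) mE.
  by rewrite mE eqxx in gm'.
Qed.

(** * Monomials outside the leading exponents as a basis of the quotient by [J] *)

Variables (V : vectType F) (h : {linear {mpoly F[s]} -> V}).
Hypothesis h_ker : forall f, h f = 0 <-> J f.
Hypothesis h_surj : forall v, exists f, h f = v.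

Lemma footprint_basis (D : seq 'X_{1..s}) : uniq D ->
    (forall m, m \in D <-> ~ lead_exps J m) ->
  basis_of fullv [seq h 'X_[m] | m <- D].
Proof.
move=> D_uniq DE; have [anti _ _ _ wf] := leT_mon.
apply/andP; split; last first.
  (* A nonzero [f] in [J] supported on [D] would have its leading exponent in [D]. *)
  apply: free_monomials => // f fD /h_ker Jf; apply/eqP/negP => /negP f0.
  have /fD/DE := LP_supp f0; apply.
  by exists f.
apply/eqP/(@span_monomials _ _ _ h) => //; apply: contrapT.
(* Take the [leT]-least exponent whose image escapes the span. *)
move=> /existsNP mN0; have [m mN m_min] := wf _ mN0.
have [/DE mD|/contrapT/lead_exps_monic[f [Jf fm f1]]] := EM (~ lead_exps J m).
  by apply: mN; apply/memv_span/map_f.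
apply: mN; have /h_ker := Jf.
have f0 : f != 0.
  by apply: contra_eq_neq f1 => ->; rewrite /LC mcoeff0 eq_sym oner_neq0.
(* Since [h f = 0], the image of ['X_[m]] is minus that of the tail of [f], whose exponents are
   smaller than [m]. *)
rewrite {1}[f]mpolyE (bigD1_seq m) ?msupp_uniq //=; last by rewrite -fm LP_supp.
have -> : f@_m = 1 by rewrite -fm.
rewrite scale1r linearD => /eqP.
rewrite addr_eq0 => /eqP ->; rewrite rpredN linear_sum big_seq_cond.
apply: rpred_sum => m' /andP[/LP_max m'm m'Nm]; rewrite linearZ rpredZ //.
apply: contrapT => /m_min mm'; case/negP: m'Nm.
by apply/eqP/anti; rewrite mm' -fm m'm.
Qed.

End Ideal.

End LeadingTerms.

Lemma mnm1_mulm_le (s : nat) (i : 'I_s) k (m : 'X_{1..s}) :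
  (U_(i) *+ k <= m)%MM = (k <= m i)%N.
Proof.
apply/mnm_lepP/idP => [/(_ i)|km j]; rewrite mulmnE mnm1E ?eqxx ?mul1n //.
by case: eqP => [<-|_]; rewrite ?mul1n.
Qed.

(** * Reduction of exponents and the dimension of F[X]/K *)

Section Reduction.
Variables (F : fieldType) (s : nat) (r : 'I_s -> nat).
Hypothesis r_gt0 : forall i, (0 < r i)%N.
Implicit Types (f g : {mpoly F[s]}) (m b : 'X_{1..s}).

Definition mod_mnm m : 'X_{1..s} := [multinom (m i %% r i)%N | i < s].

(* The coefficient of X^b in the reduction of f modulo K. *)
Definition mod_coeff b f : F :=
  \sum_(m <- msupp f) f@_m * (mod_mnm m == b)%:R.

(** Allows several polynomials to be summed over one common list, as additivity requires. *)
Lemma mod_coeff_widen b f (l : seq 'X_{1..s}) :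
    uniq l -> {subset msupp f <= l} ->
  mod_coeff b f = \sum_(m <- l) f@_m * (mod_mnm m == b)%:R.
Proof.
move=> l_uniq fl; rewrite [RHS](bigID (mem (msupp f))) /=.
rewrite [X in _ + X]big1 => [|m /memN_msupp_eq0 ->]; last by rewrite mul0r.
rewrite addr0 -[RHS]big_filter; apply: perm_big; apply: uniq_perm => //.
  exact: filter_uniq.
by move=> m; rewrite mem_filter; apply/idP/andP => [mf|[]//]; split=> //; apply: fl.
Qed.

Lemma mod_coeffD b f g : mod_coeff b (f + g) = mod_coeff b f + mod_coeff b g.
Proof.
pose l := undup (msupp f ++ msupp g).
have l_uniq : uniq l by rewrite undup_uniq.
have fl : {subset msupp f <= l}.
  by move=> m mf; rewrite mem_undup mem_cat mf.
have gl : {subset msupp g <= l}.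
  by move=> m mg; rewrite mem_undup mem_cat mg orbT.
have fgl : {subset msupp (f + g) <= l}.
  by move=> m /msuppD_le; rewrite mem_undup.
rewrite !(@mod_coeff_widen _ _ l) // -big_split /=; apply: eq_bigr => m _.
by rewrite mcoeffD mulrDl.
Qed.

Lemma mod_coeffZX b c m : mod_coeff b (c *: 'X_[m]) = c * (mod_mnm m == b)%:R.
Proof.
rewrite (@mod_coeff_widen _ _ [:: m]) ?big_seq1 ?mcoeffZ ?mcoeffX ?eqxx ?mulr1 //.
by move=> m' /msuppZ_le; rewrite msuppX.
Qed.

Lemma mod_coeff0 b : mod_coeff b 0 = 0.
Proof. by rewrite /mod_coeff msupp0 big_nil. Qed.

Lemma mod_coeff_sum b (I : Type) (l : seq I) (f : I -> {mpoly F[s]}) :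
  mod_coeff b (\sum_(i <- l) f i) = \sum_(i <- l) mod_coeff b (f i).
Proof. exact: (big_morph _ (mod_coeffD b) (mod_coeff0 b)). Qed.

(** A monomial times ['X_i ^+ r i - 1] is a difference of two monomials whose exponents have the
    same residues. *)
Lemma mod_coeff_cyclic b f : f \in @cyclic_ideal F s r -> mod_coeff b f = 0.
Proof.
move=> /asboolP[c cS ->]; rewrite mod_coeff_sum big_seq big1 // => -[a g].
move=> /cS[i _ /= <-]; rewrite [a]mpolyE mulr_suml mod_coeff_sum big1 // => m _.
rewrite mulrBr mulr1 -scalerAl mpolyXn -mpolyXD -scaleNr.
rewrite mod_coeffD !mod_coeffZX mulNr.
suff -> : mod_mnm (m + U_(i) *+ r i)%MM = mod_mnm m by rewrite subrr.
apply/mnmP => j; rewrite [LHS]mnmE [RHS]mnmE mnmDE mulmnE mnm1E.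
by case: eqP => [->|_]; rewrite ?mul1n ?modnDr // mul0n addn0.
Qed.

(** Indexing by dependent finite functions makes the size a product of the [r i]. *)
Definition box : seq 'X_{1..s} :=
  [seq [multinom (d i : nat) | i < s] | d : {dffun forall i, 'I_(r i)}].

Lemma mem_box m : (m \in box) = [forall i, (m i < r i)%N].
Proof.
apply/mapP/forallP => [[d _ -> i]|m_lt]; first by rewrite mnmE.
exists [ffun i : 'I_s => Ordinal (m_lt i)]; first by rewrite mem_enum.
by apply/mnmP => i; rewrite mnmE ffunE.
Qed.

Lemma box_uniq : uniq box.
Proof.
rewrite map_inj_uniq ?enum_uniq // => d1 d2 /mnmP dE.
by apply/ffunP => i; apply: val_inj; have := dE i; rewrite !mnmE.
Qed.

Lemma size_box : size box = (\prod_(i < s) r i)%N.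
Proof.
rewrite size_map -cardE card_dep_ffun foldrE big_image /=.
by apply: eq_bigr => i _; rewrite card_ord.
Qed.

Lemma cls_eq0 f : (cls r_gt0 f == 0) = (f \in @cyclic_ideal F s r).
Proof. by rewrite -(raddf0 (cls r_gt0)) /cls -Quotient.idealrBE subr0. Qed.

(** On polynomials supported in [box r], [mod_coeff b] is the plain coefficient at [b], which gives
    independence. Spanning follows by lowering exponents by [r i], by induction on the degree. *)
Lemma box_basis :
  basis_of {: abelian_alg F r_gt0} [seq cls r_gt0 'X_[m] | m <- box].
Proof.
apply/andP; split; last first.
  apply: (free_monomials box_uniq) => f f_box.
  move=> /eqP; rewrite cls_eq0 => fK; apply/mpolyP => b; rewrite mcoeff0.
  have [/f_box b_box|/memN_msupp_eq0 //] := boolP (b \in msupp f).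
  have mod_box m : m \in box -> mod_mnm m = m.
    by rewrite mem_box => /forallP m_lt; apply/mnmP => i; rewrite mnmE modn_small.
  rewrite -(mod_coeff_cyclic b fK) (mod_coeff_widen _ box_uniq f_box).
  rewrite (bigD1_seq b) ?box_uniq //= mod_box // eqxx mulr1 big_seq_cond.
  rewrite big1 ?addr0 // => m /andP[m_box mb].
  by rewrite mod_box // (negPf mb) mulr0.
apply/eqP/span_monomials => [|m]; first exact: cls_surj.
rewrite -[_ 'X_[m]]/(cls r_gt0 'X_[m]).
have [k] := ubnP (mdeg m); elim: k m => // k IHk m mk.
have [m_box|] := boolP (m \in box); first exact/memv_span/map_f.
rewrite mem_box => /forallPn[i]; rewrite -leqNgt => rm.
have -> := cls_X_subU F r_gt0 rm; apply: IHk.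
have rm' : (U_(i) *+ r i <= m)%MM by rewrite mnm1_mulm_le.
(* Positivity of [r i] makes the degree drop strictly. *)
move: mk; rewrite -{1}(submK rm') mdegD mdegMn mdeg1 mul1n.
by rewrite ltnS; apply: leq_trans; rewrite -addn1 leq_add2l.
Qed.

End Reduction.

(** * The footprint of an abelian code *)

Section Footprint.
Variables (F : fieldType) (s : nat) (r : 'I_s -> nat).
Hypothesis r_gt0 : forall i, (0 < r i)%N.
Variables (leT : rel 'X_{1..s}) (C : ideal (abelian_alg F r_gt0)).
Hypothesis leT_mon : monomial_order leT.

Let J := code_preim C.

Let J_lin a f g : J f -> J g -> J (a * f + g).
Proof.
move=> Jf Jg; rewrite /J /code_preim /= rmorphD rmorphM /=.
by rewrite rpredD // ideal_absorb.
Qed.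

Let J0 : J 0.
Proof. by rewrite /J /code_preim /= raddf0 rpred0. Qed.

(** The witness ['X_i ^+ r i - 1] lies in K, hence in [J], and the exponent of its constant term is
    the least of all. *)
Lemma lead_exps_cyclic i : lead_exps leT J (U_(i) *+ r i)%MM.
Proof.
pose f : {mpoly F[s]} := 'X_i ^+ r i - 1.
have rN0 : (U_(i) *+ r i)%MM != 0%MM.
  by rewrite -mdeg_eq0 mdegMn mdeg1 mul1n -lt0n.
have fm : (U_(i) *+ r i)%MM \in msupp f.
  rewrite mcoeff_msupp mcoeffB mpolyXn mcoeffX eqxx mcoeff1 (negPf rN0).
  by rewrite subr0 oner_neq0.
exists f; first split.
- rewrite /J /code_preim /=.
  suff /eqP -> : cls r_gt0 f == 0 by rewrite rpred0.
  by rewrite cls_eq0; apply/asboolP/gen_ideal_gen; exists i.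
- by rewrite -msupp_eq0; case: (msupp f) fm.
- apply: LP_eq => // m /msuppB_le; rewrite mem_cat mpolyXn msuppX msupp1 !inE.
  case/orP => /eqP ->; first exact: monomial_order_refl.
  exact: monomial_order0.
Qed.

(* J contains X_i^(r_i) - 1, so every minimal leading exponent m satisfies
   m_i <= r_i; this replaces Dickson's lemma in the existence of a minimal
   Groebner basis. *)
Lemma footprintE : footprint C leT = (~` lead_exps leT J)%classic.
Proof.
rewrite /footprint (upset_lead_exps leT_mon J_lin J0) //.
apply: xgetPex; apply: (minimal_groebner_basis_exists leT_mon J_lin J0).
apply: (@sub_finite_set _ _ [set` box (fun i => (r i).+1)]) => [m [_ m_min]|].
  rewrite /= mem_box; apply/forallP => i; rewrite ltnS leqNgt; apply/negP => rm.
  have := m_min _ (lead_exps_cyclic i); rewrite mnm1_mulm_le ltnW // => /(_ isT).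
  by move/mnmP/(_ i)/eqP; rewrite mulmnE mnm1E eqxx mul1n ltn_eqF.
exact: finite_seq.
Qed.

(** An exponent with some [m i] at least [r i] is a multiple of a leading exponent, so the footprint
    lies in [box r]. *)
Lemma footprint_finite : finite_set (footprint C leT).
Proof.
apply: (@sub_finite_set _ _ [set` box r]); last exact: finite_seq.
rewrite footprintE => m mN /=; rewrite mem_box; apply/forallP => i.
rewrite ltnNge; apply/negP => rm; apply: mN.
have rm' : (U_(i) *+ r i <= m)%MM by rewrite mnm1_mulm_le.
rewrite -(submK rm') addmC; apply: (lead_exps_up leT_mon J_lin J0).
exact: lead_exps_cyclic.
Qed.

(** The composite projection from F[X] is onto with kernel exactly [J]. *)
Lemma footprint_code_basis :
  basis_of {: code_quot C}
    [seq qcls C (cls r_gt0 'X_[m]) | m <- fset_set (footprint C leT)].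
Proof.
apply: (@footprint_basis _ _ leT_mon _ J J_lin J0 _ (qcls C \o cls r_gt0)).
- by move=> f; split=> [/eqP|Jf]; [|apply/eqP]; rewrite /= qcls_eq0.
- move=> v; have [f fv] := cls_surj (repr v).
  by exists f; rewrite /= fv qcls_repr.
- exact: fset_uniq.
- move=> m; rewrite in_fset_set ?footprintE; last first.
    by rewrite -footprintE; apply: footprint_finite.
  by split=> [/set_mem|mN]; last exact: mem_set.
Qed.

(** Rank-nullity for the projection modulo [C], whose kernel is [code_space C] and whose image is
    everything. *)
Lemma dim_code_space :
  (\dim (code_space C) + \dim {: code_quot C})%N = (\prod_(i < s) r i)%N.
Proof.
have := basis_of_dim (box_basis F r_gt0); rewrite size_map size_box => <-.
rewrite -(limg_ker_dim (linfun (qcls C)) fullv) capfv.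
congr (_ + \dim _)%N; apply/vspaceP => v; rewrite memvf; apply/esym/memv_imgP.
by exists (repr v); rewrite ?memvf // lfunE /= qcls_repr.
Qed.

End Footprint.

Theorem theorem27 (F : finFieldType) (s : nat) (r : 'I_s -> nat)
    (r_gt0 : forall i, (0 < r i)%N)
    (coprime_nq : coprime (\prod_(i < s) r i)%N #|F|)
    (leT : rel 'X_{1..s}) (leT_mon : monomial_order leT)
    (C : ideal (abelian_alg F r_gt0)) :
  [/\ finite_set (footprint C leT),
      basis_of {: code_quot C}
        [seq qcls C (cls r_gt0 'X_[m]) | m <- fset_set (footprint C leT)]
    & (\dim (code_space C))%:Z =
        (\prod_(i < s) r i)%N%:Z - #|` fset_set (footprint C leT)|%:Z].
Proof.
have C_basis := footprint_code_basis C leT_mon.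
split=> //; first exact: footprint_finite.
by rewrite -(dim_code_space C) (basis_of_dim C_basis) size_map PoszD addrK.
Qed.
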